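(* Let $\mathcal{U}$ be a Polish space, $\Theta$ a non-empty compact metric space, and $\{f_\theta:\theta\in\Theta\}$ a family of functions $f_\theta:\mathcal{U}\to\mathbb{R}$ such that $(\theta,u)\mapsto f_\theta(u)$ is continuous from $\Theta\times\mathcal{U}$ to $\mathbb{R}$. Let $\ell_0:\mathbb{R}\times\mathbb{R}\to[0,\infty)$ be lower semicontinuous. Let $(U_0,V_0),(U_1,V_1),\dots$ be a stationary ergodic process with values in $\mathcal{U}\times\mathbb{R}$, and let $(U,V)$ have the same distribution as $(U_0,V_0)$. Let $\theta_n:(\mathcal{U}\times\mathbb{R})^n\to\Theta$, $n\ge1$, be measurable functions such that, with $\hat\theta_n=\theta_n((U_0,V_0),\dots,(U_{n-1},V_{n-1}))$, $$\lim_n\frac1n\sum_{i=0}^{n-1}\ell_0(f_{\hat\theta_n}(U_i),V_i)=\lim_n\inf_{\theta\in\Theta}\frac1n\sum_{i=0}^{n-1}\ell_0(f_\theta(U_i),V_i)\quad\text{with probability one}.$$ If $\mathbb{E}\sup_{\theta\in\Theta}\ell_0(f_\theta(U),V)$ is finite, then $\hat\theta_n$ converges almost surely to the set $$\Theta_0=\operatorname*{argmin}_{\theta\in\Theta}\ \mathbb{E}\,\ell_0(f_\theta(U),V).$$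
   Context: A sequence in $\Theta$ converges to a set $\Theta_0$ if the distance from its $n$-th term to $\Theta_0$ tends to $0$. *)

(* Defs.v *)
From HB Require Import structures.
From mathcomp Require Export all_boot all_order all_algebra.
From mathcomp Require Export all_classical all_reals all_analysis.
Export numFieldNormedType.Exports.

Set Implicit Arguments.
Unset Strict Implicit.
Unset Printing Implicit Defensive.

Import Order.TTheory GRing.Theory Num.Theory.

Local Open Scope classical_set_scope.
Local Open Scope ring_scope.

(* Measurable types are pointed in the library, so non-emptiness of a space is
   expressed by pointedness. *)
#[short(type="pmetricType")]
HB.structure Definition PointedMetric (K : numDomainType) :=
  { M of Pointed M & Metric K M }.

Notation borelType T := (g_sigma_algebraType (@open T)).

Definition separable_space (T : topologicalType) :=
  exists2 D : set T, countable D & dense D.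

Definition is_metric (R : realType) (T : Type) (dist : T -> T -> R) :=
  [/\ forall x y, 0 <= dist x y,
      forall x y, dist x y = 0 <-> x = y,
      forall x y, dist x y = dist y x &
      forall x y z, dist x z <= dist x y + dist y z].

Definition metrizes (R : realType) (T : topologicalType) (dist : T -> T -> R) :=
  forall A : set T, open A <->
    forall x, A x -> exists2 e : R, 0 < e & [set y | dist x y < e] `<=` A.

Definition complete_metric (R : realType) (T : topologicalType)
    (dist : T -> T -> R) :=
  forall x : nat -> T,
    (forall e : R, 0 < e -> exists N, forall m n,
       (N <= m)%N -> (N <= n)%N -> dist (x m) (x n) < e) ->
    exists l : T, x n @[n --> \oo] --> l.

Definition polish (R : realType) (T : topologicalType) :=
  separable_space T /\
  exists dist : T -> T -> R,
    [/\ is_metric dist, metrizes dist & complete_metric dist].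

(* The product sigma-algebra on the space of sequences in T. *)
Definition path_measurable d (T : measurableType d) : set (set (nat -> T)) :=
  <<s [set B | exists i, exists2 A, measurable A & B = [set x | A (x i)]] >>.

Definition path_shift (T : Type) (x : nat -> T) : nat -> T := fun n => x n.+1.

Section process.
Context d d' (Omega : measurableType d) (T : measurableType d') (R : realType).
Variables (P : probability Omega R) (X : nat -> Omega -> T).

Definition trajectory (w : Omega) : nat -> T := fun n => X n w.

Definition stationary := forall A : set (nat -> T), path_measurable A ->
  P [set w | A (path_shift (trajectory w))] = P [set w | A (trajectory w)].

Definition ergodic := forall A : set (nat -> T), path_measurable A ->
  @path_shift T @^-1` A = A ->
  P [set w | A (trajectory w)] = 0%E \/ P [set w | A (trajectory w)] = 1%E.

End process.

Definition empirical_risk (R : realType) (Theta U : Type)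
    (l0 : R * R -> R) (f : Theta -> U -> R)
    (n : nat) (x : nat -> U * R) (t : Theta) : R :=
  n%:R^-1 * \sum_(i < n) l0 (f t (x i).1, (x i).2).

Definition argmin (R : realType) (Theta : Type) (g : Theta -> \bar R) :
    set Theta := [set t | forall s, (g t <= g s)%E].

(* The distance to the empty set is +oo: convergence entails that A is
   non-empty. *)
Definition cvg_to_set (R : realType) (Theta : metricType R)
    (t : nat -> Theta) (A : set Theta) :=
  edist_inf A (t n) @[n --> \oo] --> 0%E.

(* Main.v *)
From HB Require Import structures.
Require Import Defs.
From mathcomp Require Import measurable_realfun lra.

Set Implicit Arguments.
Unset Strict Implicit.
Unset Printing Implicit Defensive.

Import Order.TTheory GRing.Theory Num.Theory.

Local Open Scope classical_set_scope.
Local Open Scope ring_scope.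

(** Write L(t) for the expected loss at t and A_n(t) for the average of the
    first n losses at t.

    Suppose that t does not minimize L.  Then L(s) < a < b < L(t) for some s and
    some reals a, b.  By the ergodic theorem A_n(s) <= a + o(1) almost surely,
    so the limit of the infima of A_n is at most a ([ae_limit_risk_le]).  On the
    other hand the loss is lower semicontinuous in the parameter, so its infimum
    over a small compact neighbourhood of t increases to the loss at t when the
    neighbourhood shrinks; by monotone convergence there is a neighbourhood K
    over which the infimum still has expectation above b
    ([expected_risk_lt_inf_over]).  The ergodic theorem for this infimum bounds
    A_n from below by b - o(1) simultaneously at all points of K.  As the risk
    of the estimators has the same limit as the infimum, almost surely the
    estimators leave K for good ([ae_eventually_avoid]).  The parameters at
    distance at least 1/(k+1) from the set of minimizers form a compact set,
    covered by finitely many such neighbourhoods; hence the estimators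
    eventually leave it ([ae_cvg_argmin]).  This also shows that a minimizer
    exists: were there none, the estimators would eventually leave the whole
    parameter space.

    Two ingredients are established on the way.  The first is the ergodic
    theorem, in the form of one-sided bounds n a + C and n b - C on partial
    sums.  It rests on the maximal inequality for a measure preserving map
    ([maximal_inequality]), applied to the shift on the space of trajectories.
    The second is the measurability of infima of the loss over compact sets of
    parameters ([measurable_inf_over]): these infima are again lower
    semicontinuous, and open subsets of the product of the observation space
    with the real line are countable unions of measurable rectangles. *)

(** * Monotone convergence *)

Lemma integral_lt_monotone d (S : measurableType d) (R : realType)
    (mu : {measure set S -> \bar R}) (g_ : nat -> S -> R) (g : S -> R) (b : \bar R) :
  (forall n, measurable_fun setT (g_ n)) -> (forall n x, 0 <= g_ n x) ->
  (forall x, nondecreasing_seq (g_ ^~ x)) ->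
  (forall x, g_ ^~ x @ \oo --> g x) ->
  (b < \int[mu]_x (g x)%:E)%E ->
  exists n, (b < \int[mu]_x (g_ n x)%:E)%E.
Proof.
move=> mg g0 ndg cvgg bg.
have cvgI : (\int[mu]_x (g_ n x)%:E)%E @[n --> \oo] --> (\int[mu]_x (g x)%:E)%E.
  have -> : (\int[mu]_x (g x)%:E = \int[mu]_x (limn (fun n => (g_ n x)%:E)))%E.
    apply: eq_integral => x _; apply/esym/cvg_lim => //.
    exact: cvg_EFin (nearW _ _) (cvgg x).
  apply: cvg_monotone_convergence => //.
  - by move=> n; exact/measurable_EFinP.
  - by move=> n x _; rewrite lee_fin.
  - by move=> x _ m n mn; rewrite lee_fin ndg.
have nbhs_b : nbhs (\int[mu]_x (g x)%:E)%E [set y | (b < y)%E].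
  by apply: open_nbhs_nbhs; split => //; exact: open_ereal_gt_ereal.
have [n _ bgn] := cvgI _ nbhs_b.
by exists n; exact: bgn (leqnn n).
Qed.

(** * One-sided ergodic theorem for a measure preserving map *)

Section ergodic_averages.
Context d (S : measurableType d) (R : realType) (mu : probability S R).
Variable tau : S -> S.
Hypothesis measurable_tau : measurable_fun [set: S] tau.
Hypothesis tau_preserves : forall A, measurable A -> mu (tau @^-1` A) = mu A.

Definition orbit_sum (h : S -> R) n x := \sum_(i < n) h (iter i tau x).

Lemma orbit_sumS h n x : orbit_sum h n.+1 x = h x + orbit_sum h n (tau x).
Proof.
rewrite /orbit_sum big_ord_recl/=; congr (_ + _).
by apply: eq_bigr => i _; rewrite -iterSr.
Qed.

Lemma measurable_orbit_sum h n :
  measurable_fun setT h -> measurable_fun setT (orbit_sum h n).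
Proof.
move=> mh; elim: n => [|n IH].
  by rewrite /orbit_sum (_ : (fun _ => _) = cst 0)//; apply/funext => x;
    rewrite big_ord0.
rewrite (_ : orbit_sum h n.+1 = h \+ (orbit_sum h n \o tau)).
  by apply: measurable_funD => //; exact: measurableT_comp.
by apply/funext => x; rewrite orbit_sumS.
Qed.

Lemma measurable_exists_orbit_sum_gt h (r : nat -> R) :
  measurable_fun setT h -> measurable [set x | exists n, r n < orbit_sum h n x].
Proof.
move=> mh; rewrite (_ : [set _ | _] =
    \bigcup_n (fun x => r n < orbit_sum h n x) @^-1` [set true]).
  apply: bigcup_measurable => n _; rewrite -[X in measurable X]setTI.
  by apply: measurable_fun_ltr => //; exact: measurable_orbit_sum.
by apply/seteqP; split=> x /= [n]; [move=> ?; exists n|move=> _ ?; exists n].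
Qed.

Lemma integral_preserved (F : S -> \bar R) : measurable_fun setT F ->
  (forall x, 0 <= F x)%E -> (\int[mu]_x F (tau x) = \int[mu]_x F x)%E.
Proof.
move=> mF F0; transitivity (\int[pushforward mu tau]_x F x)%E.
  by rewrite (ge0_integral_pushforward measurable_tau).
by apply: eq_measure_integral => A mA _; exact: tau_preserves.
Qed.

(** This is the maximum over k <= n of the sums of g along the first k points of
    the orbit of x.  The recursion on the starting point is exactly the relation
    between the maxima at x and at tau x that the maximal inequality uses. *)
Fixpoint max_excess (g : S -> R) n x : R :=
  if n is m.+1 then Num.max 0 (g x + max_excess g m (tau x)) else 0.

Lemma max_excess_ge0 g n x : 0 <= max_excess g n x.
Proof. by case: n => //= n; rewrite le_max lexx. Qed.

Lemma measurable_max_excess g n :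
  measurable_fun setT g -> measurable_fun setT (max_excess g n).
Proof.
move=> mg; elim: n => [|n IH] /=; first exact: measurable_cst.
apply: measurable_maxr => //; apply: measurable_funD => //.
exact: measurableT_comp.
Qed.

Lemma max_excess_leS g n x : max_excess g n x <= max_excess g n.+1 x.
Proof.
elim: n x => [x|n IH x]; first exact: max_excess_ge0.
rewrite [leLHS]/= [leRHS]/=.
by rewrite ge_max !le_max lexx/= lerD2l IH orbT.
Qed.

Lemma orbit_sum_le_max_excess (h : S -> R) (a : R) n x :
  orbit_sum h n x - n%:R * a <= max_excess (fun y => h y - a) n x.
Proof.
elim: n x => [x|n IH x]; first by rewrite /orbit_sum big_ord0 mul0r subr0.
rewrite orbit_sumS /= le_max; apply/orP; right.
by rewrite -nat1r mulrDl mul1r opprD addrACA lerD2l IH.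
Qed.

(** Where the maximum is positive it is attained by a nonempty sum, which starts
    with h x - a and continues along the orbit of tau x.  Where it vanishes, the
    bound is trivial because h is nonnegative. *)
Lemma max_excess_recurrence (h : S -> R) (a : R) n x :
  (forall y, 0 <= h y) ->
  a * \1_[set y | 0 < max_excess (fun y => h y - a) n.+1 y] x
    + max_excess (fun y => h y - a) n.+1 x
  <= h x + max_excess (fun y => h y - a) n (tau x).
Proof.
move=> h0; set M := max_excess _.
have M0 m y : 0 <= M m y by exact: max_excess_ge0.
rewrite indicE; have [Mpos|Mle] := ltP 0 (M n.+1 x).
  rewrite mem_set//= mulr1 {1}/M/=.
  move: Mpos; rewrite {1}/M/= lt_max ltxx/= => Mpos.
  by rewrite (max_r (ltW Mpos)) addrA [a + _]addrC subrK.
rewrite memNset/= ?mulr0 ?add0r; last by rewrite ltNge => /negP.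
by rewrite (le_trans Mle)// addr_ge0.
Qed.

(** Integrating [max_excess_recurrence], the integrals of the maxima cancel because
    tau preserves mu and the maxima increase with n, which leaves
    a * mu(0 < max) <= int h.  The maxima of order n detect whether one of the
    first n averages exceeds a; n then goes to infinity. *)
Lemma maximal_inequality (h : S -> R) (a : R) :
  measurable_fun setT h -> (forall x, 0 <= h x) -> 0 <= a ->
  (a%:E * mu [set x | exists n, (n%:R * a < orbit_sum h n x)%R]
     <= \int[mu]_x (h x)%:E)%E.
Proof.
move=> mh h0 a0; set M := max_excess (fun y => h y - a).
have mM n : measurable_fun setT (M n).
  by apply: measurable_max_excess; exact: measurable_funB.
have meM n : measurable_fun setT (fun x => (M n x)%:E).
  exact/measurable_EFinP.
have M0 n x : (0 <= (M n x)%:E)%E by rewrite lee_fin max_excess_ge0.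
have meh : measurable_fun setT (fun x => (h x)%:E) by exact/measurable_EFinP.
have h0E x : (0 <= (h x)%:E)%E by rewrite lee_fin.
have [hfin|] := ltP (\int[mu]_x (h x)%:E)%E +oo%E; last first.
  by rewrite leye_eq => /eqP ->; rewrite leey.
pose A n := [set x | 0 < M n x].
have mA n : measurable (A n).
  rewrite /A -[X in measurable X]setTI; have := mM n.
  move=> /(_ measurableT `]0, +oo[%classic); rewrite preimage_itvoy; exact.
have step n : (a%:E * mu (A n.+1) + \int[mu]_x (M n.+1 x)%:E
    <= \int[mu]_x (h x)%:E + \int[mu]_x (M n x)%:E)%E.
  have mMtau : measurable_fun setT (fun x => (M n (tau x))%:E).
    exact: (measurableT_comp (meM n)).
  have mA1 : measurable_fun setT (fun x => (\1_(A n.+1) x)%:E : \bar R).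
    by apply/measurable_EFinP; exact: measurable_indic.
  have maA1 : measurable_fun setT (fun x => a%:E * (\1_(A n.+1) x)%:E)%E.
    exact: emeasurable_funM.
  have aA10 x : (0 <= a%:E * (\1_(A n.+1) x)%:E)%E.
    by rewrite -EFinM lee_fin mulr_ge0.
  rewrite -(integral_preserved (meM n) (M0 n)).
  rewrite -[X in (_ * mu X)%E]setIT -integral_indic// -ge0_integralZl//.
  rewrite -!ge0_integralD//=; apply: ge0_le_integral => //=.
  - by move=> x _; rewrite adde_ge0.
  - exact: emeasurable_funD.
  - exact: emeasurable_funD.
  - by move=> x _; rewrite -!EFinM -!EFinD lee_fin; exact: max_excess_recurrence.
have IM0 n : (0 <= \int[mu]_x (M n x)%:E)%E by exact: integral_ge0.
(* The cancellation requires finite integrals. *)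
have IMfin n : (\int[mu]_x (M n x)%:E < +oo)%E.
  elim: n => [|n IH]; first by rewrite /M/= integral0.
  apply: le_lt_trans (lte_add_pinfty hfin IH); apply: le_trans (step n).
  by rewrite leeDr// mule_ge0.
have bound n : (a%:E * mu (A n) <= \int[mu]_x (h x)%:E)%E.
  case: n => [|n].
    rewrite /A /M/= (_ : [set _ | _] = set0) ?measure0 ?mule0 ?integral_ge0//.
    by apply/seteqP; split => x //=; rewrite ltxx.
  have finM : (\int[mu]_x (M n.+1 x)%:E)%E \is a fin_num.
    by rewrite ge0_fin_numE.
  rewrite -(leeD2rE _ _ finM); apply: le_trans (step n) _.
  rewrite leeD2l//; apply: ge0_le_integral => // x _.
  by rewrite lee_fin max_excess_leS.
have mUA : measurable (\bigcup_n A n) by exact: bigcup_measurable.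
have ndA : nondecreasing_seq A.
  apply/nondecreasing_seqP => n; apply/subsetPset => x; rewrite /A/=.
  by move=> /lt_le_trans; apply; exact: max_excess_leS.
have limA : mu \o A @ \oo --> mu (\bigcup_n A n).
  exact: nondecreasing_cvg_mu.
apply: (@le_trans _ _ (a%:E * mu (\bigcup_n A n))%E).
  rewrite lee_wpmul2l ?lee_fin//; apply: le_measure; rewrite ?inE//.
    exact: measurable_exists_orbit_sum_gt.
  move=> x [n nx]; exists n => //=.
  by apply: lt_le_trans (orbit_sum_le_max_excess _ _ _ _); rewrite subr_gt0.
have := cvgeZl (_ : a%:E \is a fin_num) limA.
move=> /(_ isT) /cvg_lim <-//; apply: lime_le.
  by apply: is_cvgeZl => //; exact: cvgP limA.
by apply: nearW => n /=.
Qed.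

Hypothesis tau_ergodic : forall A, measurable A -> tau @^-1` A = A ->
  mu A = 0%E \/ mu A = 1%E.

(** The points where the differences between the orbit sums of length n and n a
    are unbounded above form an invariant set: replacing x by tau x changes
    these differences by h x - a and a shift of the index.  By the maximal
    inequality its measure is at most (int h) / a < 1, so ergodicity makes it
    null. *)
Lemma ae_orbit_sum_le (h : S -> R) (a : R) :
  measurable_fun setT h -> (forall x, 0 <= h x) ->
  (\int[mu]_x (h x)%:E < a%:E)%E ->
  {ae mu, forall x, exists C, forall n, orbit_sum h n x <= n%:R * a + C}.
Proof.
move=> mh h0 ha.
have a0 : 0 <= a.
  by rewrite -lee_fin (le_trans _ (ltW ha))// integral_ge0// => x _; rewrite lee_fin.
pose E := [set x | forall k, exists n, n%:R * a + k%:R < orbit_sum h n x].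
have mE : measurable E.
  rewrite (_ : E =
      \bigcap_k [set x | exists n, n%:R * a + k%:R < orbit_sum h n x]).
    by apply: bigcapT_measurable => k; exact: measurable_exists_orbit_sum_gt.
  by apply/seteqP; split=> x /= Ex k; [move=> _; exact: Ex|exact: Ex].
have E_real x : E x -> forall c, exists n, n%:R * a + c < orbit_sum h n x.
  move=> Ex c; have [n nE] := Ex (Num.trunc c).+1; exists n.
  by rewrite (le_lt_trans _ nE)// lerD2l ltW// truncnS_gt.
have Einv : tau @^-1` E = E.
  apply/seteqP; split => x Ex k.
    have [n nE] := E_real _ Ex (k%:R + a); exists n.+1.
    rewrite orbit_sumS -nat1r mulrDl mul1r.
    by have := h0 x; lra.
  (* An orbit sum of length 0 vanishes, so it cannot exceed k + h x. *)
  have [[|n] nE] := E_real _ Ex (k%:R + h x); [exfalso|exists n]; move: nE.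
    rewrite /orbit_sum big_ord0 mul0r add0r; have := h0 x.
    by have : 0 <= k%:R :> R by []; lra.
  by rewrite orbit_sumS -nat1r mulrDl mul1r; lra.
have Ele : (a%:E * mu E <= \int[mu]_x (h x)%:E)%E.
  apply: le_trans (maximal_inequality mh h0 a0).
  rewrite lee_wpmul2l ?lee_fin//; apply: le_measure; rewrite ?inE//.
    exact: measurable_exists_orbit_sum_gt.
  by move=> x /(_ 0%N)[n]; rewrite addr0; exists n.
have E0 : mu E = 0%E.
  have [//|E1] := tau_ergodic mE Einv.
  by move: (le_lt_trans Ele ha); rewrite E1 mule1 ltxx.
exists E; split => // x /= nx; apply: contrapT => nEx; apply: nx.
move/existsNP : nEx => [k /forallNP nk]; exists k%:R => n.
by rewrite leNgt; apply/negP.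
Qed.

(** The upper bound applied to M - min(g, M), where M is so large that min(g, M)
    still has integral above b; the truncation makes the reflected function
    nonnegative. *)
Lemma ae_orbit_sum_ge (g : S -> R) (b : R) :
  measurable_fun setT g -> (forall x, 0 <= g x) ->
  (b%:E < \int[mu]_x (g x)%:E)%E ->
  {ae mu, forall x, exists C, forall n, n%:R * b - C <= orbit_sum g n x}.
Proof.
move=> mg g0 bg.
pose gM (M : nat) x := Num.min (g x) M%:R.
have mgM M : measurable_fun setT (gM M).
  by apply: measurable_minr => //; exact: measurable_cst.
have gM0 M x : 0 <= gM M x by rewrite le_min g0/=.
have [M bM] : exists M, (b%:E < \int[mu]_x (gM M x)%:E)%E.
  apply: (integral_lt_monotone mgM gM0 _ _ bg) => [x m n mn|x].
    by rewrite le_min !ge_min lexx/= ler_nat mn orbT.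
  apply: cvg_near_cst; near=> M; apply/min_idPl.
  by near: M; exact: nbhs_infty_ger.
pose h x := M%:R - gM M x.
have mh : measurable_fun setT h.
  by apply: measurable_funB => //; exact: measurable_cst.
have h0 x : 0 <= h x by rewrite subr_ge0 ge_min lexx orbT.
have hgM : (\int[mu]_x (h x)%:E + \int[mu]_x (gM M x)%:E = M%:R%:E)%E.
  rewrite -ge0_integralD//; last 4 first.
  - by move=> x _; rewrite lee_fin.
  - exact/measurable_EFinP.
  - by move=> x _; rewrite lee_fin.
  - exact/measurable_EFinP.
  under eq_integral do rewrite -EFinD subrK.
  by rewrite integral_cst// [X in (_ * X)%E](@probability_setT _ _ _ mu) mule1.
have hM : (\int[mu]_x (h x)%:E < (M%:R - b)%:E)%E.
  move: hgM bM; have : (0 <= \int[mu]_x (h x)%:E)%E.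
    by apply: integral_ge0 => x _; rewrite lee_fin.
  case: (integral _ _ _) (integral _ _ _) => [u| |] [v| |]//= _ [uv].
  by rewrite !lte_fin -uv; lra.
apply: filterS (ae_orbit_sum_le mh h0 hM) => x [C hC]; exists C => n.
have : orbit_sum h n x = n%:R * M%:R - orbit_sum (gM M) n x.
  by rewrite /orbit_sum sumrB sumr_const card_ord mulr_natl.
have : orbit_sum (gM M) n x <= orbit_sum g n x.
  by apply: ler_sum => i _; rewrite ge_min lexx.
by have := hC n; lra.
Unshelve. all: by end_near. Qed.

End ergodic_averages.

(** * Partial sums of a stationary ergodic process *)

Section stationary_ergodic_process.
Context d d' (Omega : measurableType d) (T : measurableType d') (R : realType).
Variables (P : probability Omega R) (X : nat -> {mfun Omega >-> T}).
Hypotheses (stationaryX : stationary P X) (ergodicX : ergodic P X).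

(** The generating sets are those of [path_measurable], so that stationarity and
    ergodicity are literally statements about the shift on this space under the
    law of the trajectory. *)
Definition path_space := g_sigma_algebraType
  [set B : set (nat -> T) |
    exists i, exists2 A, measurable A & B = [set x | A (x i)]].

Let law_of_path : Omega -> path_space := trajectory X.

Lemma measurable_coordinate i :
  measurable_fun setT (fun x : path_space => x i).
Proof.
move=> _ A mA; rewrite setTI; apply: sub_sigma_algebra.
by exists i, A.
Qed.

Lemma measurable_to_path d1 (S : measurableType d1) (F : S -> path_space) :
  (forall i, measurable_fun setT (fun s => F s i)) -> measurable_fun setT F.
Proof.
move=> mF; apply: (@measurability _ _ _ path_space _ _ _ (erefl _)).
by move=> _ [_ [i [A mA ->]] <-]; exact: mF.
Qed.

Lemma measurable_trajectory : measurable_fun setT law_of_path.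
Proof. by apply: measurable_to_path => i; exact: measurable_funPT. Qed.

Let shift : path_space -> path_space := @path_shift T.

Let measurable_shift : measurable_fun setT shift.
Proof. by apply: measurable_to_path => i; exact: measurable_coordinate. Qed.

HB.instance Definition _ := isMeasurableFun.Build _ _ _ _ law_of_path
  measurable_trajectory.

Let mu : probability path_space R := distribution P law_of_path.

Let iter_shift n (x : path_space) : iter n shift x = fun i => x (n + i)%N.
Proof.
elim: n x => // n IH x; rewrite iterSr IH; apply/funext => i.
by rewrite /shift /path_shift addSn.
Qed.

Let orbit_sum_trajectory (phi : T -> R) n w :
  orbit_sum shift (fun x : path_space => phi (x 0%N)) n (law_of_path w) =
  \sum_(i < n) phi (X i w).
Proof.
by apply: eq_bigr => i _; rewrite iter_shift addn0.
Qed.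

Let integral_trajectory (phi : T -> R) : measurable_fun setT phi ->
  (forall t, 0 <= phi t) ->
  (\int[mu]_x (phi (x 0%N))%:E = \int[P]_w (phi (X 0%N w))%:E)%E.
Proof.
move=> mphi phi0; rewrite [LHS]ge0_integral_distribution//.
  apply/measurable_EFinP; apply: measurableT_comp => //.
  exact: measurable_coordinate.
by move=> x; rewrite lee_fin.
Qed.

Let shift_preserves (A : set path_space) :
  measurable A -> mu (shift @^-1` A) = mu A.
Proof. exact: stationaryX. Qed.

Let shift_ergodic (A : set path_space) : measurable A ->
  shift @^-1` A = A -> mu A = 0%E \/ mu A = 1%E.
Proof. exact: ergodicX. Qed.

Let ae_trajectory (A : set path_space) :
  {ae mu, forall x, A x} -> {ae P, forall w, A (law_of_path w)}.
Proof.
move=> [N [mN N0 AN]]; exists (law_of_path @^-1` N); split => //.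
- by rewrite -[X in measurable X]setTI; exact: measurable_trajectory.
- by move=> w /AN.
Qed.

Lemma ae_partial_sum_le (phi : T -> R) (a : R) :
  measurable_fun setT phi -> (forall t, 0 <= phi t) ->
  (\int[P]_w (phi (X 0%N w))%:E < a%:E)%E ->
  {ae P, forall w, exists C, forall n, \sum_(i < n) phi (X i w) <= n%:R * a + C}.
Proof.
move=> mphi phi0; rewrite -integral_trajectory// => phia.
have mphi' : measurable_fun setT (fun x : path_space => phi (x 0%N)).
  by apply: measurableT_comp => //; exact: measurable_coordinate.
have := ae_orbit_sum_le measurable_shift shift_preserves shift_ergodic
  mphi' (fun=> phi0 _) phia.
move/ae_trajectory; apply: filterS => w [C hC]; exists C => n.
by rewrite -orbit_sum_trajectory.
Qed.

Lemma ae_partial_sum_ge (phi : T -> R) (b : R) :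
  measurable_fun setT phi -> (forall t, 0 <= phi t) ->
  (b%:E < \int[P]_w (phi (X 0%N w))%:E)%E ->
  {ae P, forall w, exists C, forall n, n%:R * b - C <= \sum_(i < n) phi (X i w)}.
Proof.
move=> mphi phi0; rewrite -integral_trajectory// => phib.
have mphi' : measurable_fun setT (fun x : path_space => phi (x 0%N)).
  by apply: measurableT_comp => //; exact: measurable_coordinate.
have := ae_orbit_sum_ge measurable_shift shift_preserves shift_ergodic
  mphi' (fun=> phi0 _) phib.
move/ae_trajectory; apply: filterS => w [C hC]; exists C => n.
by rewrite -orbit_sum_trajectory.
Qed.

End stationary_ergodic_process.

(** * Open sets of a product are measurable *)

(** The balls of radius 1/(n+1) centred in a countable dense set form a countable
    basis. *)
Lemma separable_metrizable_second_countable (R : realType) (T : topologicalType)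
    (dist : T -> T -> R) :
  is_metric dist -> metrizes dist -> separable_space T -> second_countable (T := T).
Proof.
move=> [dist_ge0 dist0 distC distD] distO [D cD dD].
pose B (p : T * nat) := [set y | dist p.1 y < p.2.+1%:R^-1].
have oB p : open (B p).
  apply/distO => y /= py; exists (p.2.+1%:R^-1 - dist p.1 y) => [|z /= yz].
    by rewrite subr_gt0.
  by apply: le_lt_trans (distD _ y _) _; rewrite -ltrBrDl.
exists (B @` (D `*` setT)).
  exact: sub_countable (card_image_le _ _) (countableX _ _).
split=> [_ [p _ <-]//|x A]; rewrite nbhsE => -[A' [oA' A'x] A'A].
have [e e0 eA'] := (distO A').1 oA' x A'x.
have [n] : exists n, n.+1%:R^-1 < e / 2.
  have [n] := @ltr_add_invr R 0 (e / 2) (divr_gt0 e0 (ltr0Sn _ _)).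
  by rewrite add0r => ne; exists n.
move=> ne.
have [y [xy Dy]] : B (x, n) `&` D !=set0.
  apply: dD (oB _); exists x; rewrite /B/=.
  by rewrite (dist0 x x).2// invr_gt0.
exists (B (y, n)); first split.
- by exists (y, n).
- by rewrite /B/= distC.
- move=> z /= yz; apply: A'A; apply: eA' => /=.
  rewrite [e]splitr; apply: le_lt_trans (distD _ y _) _.
  by rewrite ltrD// (lt_trans _ ne).
Qed.

Lemma polish_second_countable (R : realType) (T : topologicalType) :
  polish R T -> second_countable (T := T).
Proof.
move=> [sepT [dist [mdist odist _]]].
exact: separable_metrizable_second_countable mdist odist sepT.
Qed.

Lemma real_second_countable (R : realType) : second_countable (T := R).
Proof.
apply: (@separable_metrizable_second_countable R R (fun x y => `|x - y|)).
- split => [x y//|x y|x y|x y z].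
  + split=> [/normr0_eq0/eqP|->]; first by rewrite subr_eq0 => /eqP.
    by rewrite subrr normr0.
  + exact: distrC.
  + exact: ler_distD.
- move=> A; rewrite openE; split=> [oA x Ax|oA x Ax].
    by have /nbhs_ballP[e /= e0 eA] := oA x Ax; exists e.
  by apply/nbhs_ballP; have [e e0 eA] := oA x Ax; exists e.
- by exists (range ratr); [exact: sub_countable (card_image_le _ _) _|exact: dense_rat].
Qed.

(** The product sigma-algebra is generated by rectangles, whereas open sets of a
    product are arbitrary unions of open rectangles; countable bases make the
    unions countable. *)
Lemma open_prod_measurable (R : realType) (U : ptopologicalType)
    (W : set (U * R)) : second_countable (T := U) -> open W ->
  measurable (W : set (borelType U * measurableTypeR R)).
Proof.
move=> [B cB [oB nB]] oW.
have [B' cB' [oB' nB']] := real_second_countable R.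
pose D := [set p : set U * set R | [/\ B p.1, B' p.2 & p.1 `*` p.2 `<=` W]].
have cD : countable D.
  apply: sub_countable (countableX cB cB'); apply: subset_card_le.
  by move=> p [].
have -> : W = \bigcup_(p in D) (p.1 `*` p.2).
  apply/seteqP; split=> [[u v] Wuv|x [p [_ _ pW] px]]; last exact: pW.
  have [/= [Q Q'] [/= nQ nQ'] QW] : nbhs (u, v) W by exact: open_nbhs_nbhs.
  have [A [BA Au] AQ] := nB u _ nQ; have [A' [BA' Av] AQ'] := nB' v _ nQ'.
  exists (A, A') => //; split => // -[x y] [/= Ax Ay].
  by apply: QW; split; [exact: AQ|exact: AQ'].
rewrite bigcup_set_type; apply: countable_bigcupT_measurable.
  by rewrite (eq_countable (card_setT D)).
case=> -[A A'] /= /set_mem[/= BA BA' _]; apply: measurableX.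
  by apply: sub_sigma_algebra; exact: oB.
by apply: open_measurable; exact: oB'.
Qed.

(** * Infima of a lower semicontinuous family over compact sets *)

Definition jointly_lsc (R : realType) (Theta X : topologicalType)
    (g : Theta -> X -> R) :=
  forall t x c, c < g t x -> \forall t' \near t & x' \near x, c < g t' x'.

Lemma jointly_lsc_loss (R : realType) (Theta U : topologicalType)
    (f : Theta -> U -> R) (l0 : R * R -> R) :
  continuous (fun p : Theta * U => f p.1 p.2) ->
  lower_semicontinuous (fun p => (l0 p)%:E) ->
  jointly_lsc (fun t (p : U * R) => l0 (f t p.1, p.2)).
Proof.
move=> cf lsc t [u v] c /= cl.
have [V nV Vc] := lsc (f t u, v) c ltac:(by rewrite lte_fin).
have [[Q1 Q2] /= [nQ1 nQ2] QV] := nV.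
have [[A B] /= [nA nB] AB] := cf (t, u) _ nQ1.
exists (A, B `*` Q2) => /=.
  by split=> //; exists (B, Q2).
move=> [t' [u' v']] /= [At' [Bu' Qv']].
by rewrite -lte_fin; apply: Vc; apply: QV; split => //; apply: (AB (t', u')).
Qed.

Section infimum_over_compact.
Context (R : realType) (Theta X : topologicalType) (g : Theta -> X -> R).
Hypotheses (lsc_g : jointly_lsc g) (g_ge0 : forall t x, 0 <= g t x).

Definition inf_over (K : set Theta) x := inf [set g t x | t in K].

Let has_lbound_g K x : has_lbound [set g t x | t in K].
Proof. by exists 0 => _ [t _ <-]. Qed.

Lemma inf_over_le K t x : K t -> inf_over K x <= g t x.
Proof. by move=> Kt; apply: ge_inf => //; exists t. Qed.

Lemma le_inf_over K x c : K !=set0 -> (forall t, K t -> c <= g t x) ->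
  c <= inf_over K x.
Proof.
move=> [t Kt] cg; apply: lb_le_inf; first by exists (g t x), t.
by move=> _ [s Ks <-]; exact: cg.
Qed.

Lemma inf_over_ge0 K x : K !=set0 -> 0 <= inf_over K x.
Proof. by move=> K0; apply: le_inf_over. Qed.

Lemma inf_over1 t x : inf_over [set t] x = g t x.
Proof. by rewrite /inf_over image_set1 inf1. Qed.

(** The tube lemma: a strict bound that holds on K at x persists near (t, x) for
    every t in K, hence, K being compact, on all of K near x. *)
Lemma open_gt_on_compact K c : compact K ->
  open [set x | forall t, K t -> c < g t x].
Proof.
move=> /compact_near_coveringP cK; rewrite openE => x cx.
apply: (cK X (nbhs x) (fun x' t => c < g t x')) => t Kt.
exact: lsc_g (cx t Kt).
Qed.

End infimum_over_compact.

(** The set where the infimum is at least c is the intersection over n of the sets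
    where all the values exceed c - 1/(n+1), which are open. *)
Lemma measurable_inf_over (R : realType) (Theta : topologicalType)
    (U : ptopologicalType) (g : Theta -> U * R -> R) (K : set Theta) :
  second_countable (T := U) -> jointly_lsc g -> (forall t x, 0 <= g t x) ->
  compact K -> K !=set0 ->
  measurable_fun setT
    (inf_over g K : borelType U * measurableTypeR R -> measurableTypeR R).
Proof.
move=> scU lsc_g g0 cK K0.
apply: (measurability _ (RGenCInfty.measurableE R)) => _ [_ [c ->] <-].
rewrite setTI preimage_itvcy.
rewrite (_ : [set _ | _] =
    \bigcap_n [set x | forall t, K t -> c - n.+1%:R^-1 < g t x]).
  apply: bigcapT_measurable => n; apply: open_prod_measurable => //.
  exact: open_gt_on_compact.
apply/seteqP; split=> x /= cx.
  move=> n _ t Kt; apply: lt_le_trans (inf_over_le g0 _ Kt).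
  by rewrite ltrBlDr (le_lt_trans cx)// ltrDl.
rewrite leNgt; apply/negP => cx'.
have [n] := ltr_add_invr cx'; rewrite -ltrBrDr => nx.
have := le_inf_over K0 (fun t Kt => ltW (cx n I t Kt)).
by rewrite leNgt nx.
Qed.

Lemma closed_ball_half_subset (R : realType) (M : pseudoMetricType R) (x : M)
    (e : R) : 0 < e -> closed_ball x (e / 2) `<=` ball x e.
Proof.
move=> e0 y /(_ (ball y (e / 2))); rewrite setIC.
have /[swap]/[apply] : nbhs y (ball y (e / 2)).
  by apply: nbhsx_ballx; rewrite divr_gt0.
by move=> [z [/ball_sym yz xz]]; rewrite [e]splitr; exact: ball_triangle xz yz.
Qed.

Lemma cvg_inf_over_balls (R : realType) (Theta : pseudoMetricType R)
    (X : topologicalType) (g : Theta -> X -> R) (t : Theta) x :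
  jointly_lsc g -> (forall t x, 0 <= g t x) ->
  inf_over g (closed_ball t n.+1%:R^-1) x @[n --> \oo] --> g t x.
Proof.
move=> lsc_g g0; apply/cvgrPdist_le => e e0.
have gte : g t x - e < g t x by rewrite ltrBlDr ltrDl.
have [[A B] /= [/nbhs_ballP[r /= r0 rA] nB] AB] := lsc_g t x _ gte.
have r20 : 0 < r / 2 by rewrite divr_gt0.
near=> n.
have tt m : closed_ball t m.+1%:R^-1 t by apply: closed_ballxx; rewrite invr_gt0.
rewrite ger0_norm ?subr_ge0 ?inf_over_le// lerBlDr -lerBlDl.
apply: le_inf_over => [|s ts]; first by exists t.
apply/ltW/(AB (s, x)); split => /=; last exact: nbhs_singleton.
apply/rA/closed_ball_half_subset => //; apply: le_closed_ball ts.
by apply: ltW; near: n; exact: near_infty_natSinv_lt (PosNum r20).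
Unshelve. all: by end_near. Qed.

(** * Lower bounds on the expected risk near a parameter *)

Section expected_risk.
Context (R : realType) (U : ptopologicalType) (Theta : metricType R).
Hypothesis scU : second_countable (T := U).
Hypothesis compactTheta : compact [set: Theta].
Variable g : Theta -> U * R -> R.
Hypotheses (lsc_g : jointly_lsc g) (g_ge0 : forall t x, 0 <= g t x).
Context d (Omega : measurableType d) (P : probability Omega R).
Variable X : {RV P >-> (borelType U * measurableTypeR R)%type}.

Definition expected_risk t := (\int[P]_w (g t (X w))%:E)%E.

Lemma measurable_loss t : measurable_fun setT
  (g t : borelType U * measurableTypeR R -> measurableTypeR R).
Proof.
rewrite (_ : g t = inf_over g [set t]).
  by apply: measurable_inf_over => //; [exact: compact_set1|exists t].
by apply/funext => x; rewrite inf_over1.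
Qed.

(** Shrinking closed balls around t are compact, and the infima over them increase
    to the loss at t. *)
Lemma expected_risk_lt_inf_over t c : (c%:E < expected_risk t)%E ->
  exists K, [/\ compact K, nbhs t K, K t &
    (c%:E < \int[P]_w (inf_over g K (X w))%:E)%E].
Proof.
move=> ct; pose K n := closed_ball t n.+1%:R^-1.
have Kt n : K n t by apply: closed_ballxx; rewrite invr_gt0.
have cK n : compact (K n).
  by apply: subclosed_compact compactTheta _ => //; exact: closed_ball_closed.
have [||||n cn] := @integral_lt_monotone _ _ _ P
    (fun n w => inf_over g (K n) (X w)) _ _ _ _ _ _ ct.
- move=> n; apply: measurableT_comp => //; apply: measurable_inf_over => //.
  by exists t.
- by move=> n w; apply: inf_over_ge0 => //; exists t.
- move=> w m n mn; apply: le_inf_over => [|s Ks]; first by exists t.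
  apply: inf_over_le => //; apply: le_closed_ball Ks.
  by rewrite lef_pV2 ?posrE// ler_nat.
- by move=> w; exact: cvg_inf_over_balls.
exists (K n); split => //.
apply: filterS (@subset_closed_ball _ _ _ _) _.
by apply: nbhsx_ballx; rewrite invr_gt0.
Qed.

End expected_risk.

(** * Consistency of approximate empirical risk minimizers *)

Lemma cvg_to_setP (R : realType) (Theta : metricType R) (t : nat -> Theta) A :
  (forall k, \forall n \near \oo, (edist_inf A (t n) < k.+1%:R^-1%:E)%E) ->
  cvg_to_set t A.
Proof.
move=> tA; apply/fine_cvgP; split.
  apply: filterS (tA 0%N) => n tn; rewrite ge0_fin_numE ?edist_inf_ge0//.
  exact: lt_trans tn (ltry _).
apply/cvgrPdist_lt => e e0.
have [k] := ltr_add_invr e0; rewrite add0r => ke.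
apply: filterS (tA k) => n tn; rewrite sub0r normrN ger0_norm ?fine_ge0 ?edist_inf_ge0//.
rewrite -lte_fin fineK; first by rewrite (lt_trans tn)// lte_fin.
by rewrite ge0_fin_numE ?edist_inf_ge0//; exact: lt_trans tn (ltry _).
Qed.

Lemma cvg_inv_natM (R : realType) (C : R) : n%:R^-1 * C @[n --> \oo] --> 0.
Proof.
rewrite -[0](mul0r C); apply: cvgMl; rewrite -cvg_shiftS.
exact: cvg_harmonic.
Qed.

Lemma two_reals_between (R : realType) (x y : \bar R) : (x < y)%E ->
  exists a b : R, [/\ (x < a%:E)%E, a < b & (b%:E < y)%E].
Proof.
case: x y => [x| |] [y| |]//; rewrite ?lte_fin => xy.
- by exists ((2 * x + y) / 3), ((x + 2 * y) / 3); rewrite !lte_fin; split; lra.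
- by exists (x + 1), (x + 2); rewrite lte_fin; split; rewrite ?ltry//; lra.
- by exists (y - 2), (y - 1); rewrite !lte_fin ltNyr; split=> //; lra.
- by exists 0, 1; rewrite ltNyr ltry.
Qed.

Section empirical_minimizers.
Context (R : realType) (U : ptopologicalType) (Theta : metricType R).
Hypothesis scU : second_countable (T := U).
Hypothesis compactTheta : compact [set: Theta].
Variable g : Theta -> U * R -> R.
Hypotheses (lsc_g : jointly_lsc g) (g_ge0 : forall t x, 0 <= g t x).
Context d (Omega : measurableType d) (P : probability Omega R).
Variable X : nat -> {RV P >-> (borelType U * measurableTypeR R)%type}.
Hypotheses (stationaryX : stationary P X) (ergodicX : ergodic P X).

Let L := expected_risk g (X 0%N).
Let risk n w t := n%:R^-1 * \sum_(i < n) g t (X i w).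

Variable thetahat : nat -> Omega -> Theta.
Hypothesis thetahat_optimal : {ae P, forall w, exists l : R,
  risk n w (thetahat n w) @[n --> \oo] --> l /\
  inf (range (risk n w)) @[n --> \oo] --> l}.

Lemma ae_limit_risk_le t (a : R) : (L t < a%:E)%E ->
  {ae P, forall w (l : R), inf (range (risk n w)) @[n --> \oo] --> l -> l <= a}.
Proof.
move=> La.
have := ae_partial_sum_le stationaryX ergodicX
  (measurable_loss scU lsc_g g_ge0 t) (g_ge0 t) La.
apply: filterS => w [C hC] l' cl.
have cvgaC : a + n%:R^-1 * C @[n --> \oo] --> a.
  by rewrite -[X in _ --> X]addr0; apply: cvgD; [exact: cvg_cst|exact: cvg_inv_natM].
apply: ler_cvg_to cl cvgaC _; near=> n.
have n0 : (0 < n)%N by near: n; exact: nbhs_infty_gt.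
apply: (@le_trans _ _ (risk n w t)).
  apply: ge_inf; last by exists t.
  by exists 0 => _ [s _ <-]; rewrite mulr_ge0// sumr_ge0.
rewrite /risk (le_trans (ler_wpM2l _ (hC n)))//.
by rewrite mulrDr mulrA mulVf ?mul1r// pnatr_eq0 -lt0n.
Unshelve. all: by end_near. Qed.

(** Near t, average losses are at least about b, by the ergodic theorem for the
    infimum of the loss over a neighbourhood; but the risk of the estimators
    converges to a limit at most a < b. *)
Lemma ae_eventually_avoid s t : (L s < L t)%E -> exists2 V, nbhs t V &
  {ae P, forall w, \forall n \near \oo, ~ V (thetahat n w)}.
Proof.
move=> st.
have [a [b [sa ab bt]]] := two_reals_between st.
have [K [cK nK Kt bK]] := expected_risk_lt_inf_over scU compactTheta lsc_g g_ge0 bt.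
exists K => //.
have mK : measurable_fun setT
    (inf_over g K : borelType U * measurableTypeR R -> measurableTypeR R).
  by apply: measurable_inf_over => //; exists t.
have K0 x : 0 <= inf_over g K x by apply: inf_over_ge0 => //; exists t.
have := ae_partial_sum_ge stationaryX ergodicX mK K0 bK.
have := ae_limit_risk_le sa.
move: thetahat_optimal; apply: filterS3 => w [l [cl1 cl2]] /(_ l cl2) la [C hC].
have lb : l < (a + b) / 2 by lra.
near=> n => Kn.
have n0 : (0 < n)%N by near: n; exact: nbhs_infty_gt.
have : risk n w (thetahat n w) < (a + b) / 2.
  by near: n; exact: cvgr_lt cl1 _ lb.
have : n%:R^-1 * C < (b - a) / 2.
  by near: n; apply: cvgr_lt (cvg_inv_natM C) _ _; lra.
have : b - n%:R^-1 * C <= risk n w (thetahat n w).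
  have nn : n%:R != 0 :> R by rewrite pnatr_eq0 -lt0n.
  rewrite -[b](mulKf nn) -mulrBr /risk ler_wpM2l// (le_trans (hC n))//.
  by apply: ler_sum => i _; apply: inf_over_le.
lra.
Unshelve. all: by end_near. Qed.

(** The exceptional null sets of [ae_eventually_avoid] depend on the parameter, so
    a finite cover has to be extracted before intersecting the almost sure
    events.  Applying the compactness of K to the filter F, which encodes
    almost surely, for all large n, on pairs (n, w), does this in one step:
    locally near each t in K, and F-eventually, the estimator differs from the
    points of K near t, hence F-eventually from all points of K. *)
Lemma ae_cvg_argmin : {ae P, forall w, cvg_to_set (thetahat^~ w) (argmin L)}.
Proof.
suff : {ae P, forall w, forall k, \forall n \near \oo,
    (edist_inf (argmin L) (thetahat n w) < k.+1%:R^-1%:E)%E}.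
  by apply: filterS => w; exact: cvg_to_setP.
apply: ae_foralln => k.
pose K := [set t | (k.+1%:R^-1%:E <= edist_inf (argmin L) t)%E].
have clK : closed K.
  apply: (@preimage_closed _ _ (edist_inf (argmin L))
    [set x | (k.+1%:R^-1%:E <= x)%E]); last exact: closed_ereal_le_ereal.
  by move=> t _; exact: edist_inf_continuous.
pose F : set_system (nat * Omega) :=
  [set A | {ae P, forall w, \forall n \near \oo, A (n, w)}].
have FF : Filter F.
  rewrite /F; split=> [|A B|A B AB] /=.
  - by apply: nearW => w; apply: nearW.
  - by apply: filterS2 => w; exact: filterI.
  - by apply: filterS => w; apply: filterS => n; exact: AB.
have cK := subclosed_compact clK compactTheta (fun _ _ => I).
have avoidK : F [set i | K `<=` (fun x => thetahat i.1 i.2 <> x)].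
  apply: (compact_near_coveringP _).1 cK _ _
    (fun i x => thetahat i.1 i.2 <> x) FF _.
  move=> t Kt; have /existsNP[s' /negP] : ~ argmin L t.
    move=> Lt; move: Kt; rewrite /K/= edist_inf0// lee_fin leNgt.
    by rewrite invr_gt0 ltr0Sn.
  rewrite -ltNge => /ae_eventually_avoid[V nV avoidV].
  exists (V, [set i | ~ V (thetahat i.1 i.2)]) => //= -[x i] /= [Vx nVi] ix.
  by apply: nVi; rewrite ix.
rewrite /F/= in avoidK.
apply: filterS avoidK => w; apply: filterS => n /= nK.
by rewrite ltNge; apply/negP => nKn; exact: (nK _ nKn).
Qed.

End empirical_minimizers.

Theorem theorem4p2 (R : realType) (U : ptopologicalType) (Theta : pmetricType R)
  (polishU : polish R U) (compactTheta : compact [set: Theta])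
  (f : Theta -> U -> R) (cont_f : continuous (fun p : Theta * U => f p.1 p.2))
  (l0 : R * R -> R) (l0_ge0 : forall p, 0 <= l0 p)
  (lsc_l0 : lower_semicontinuous (fun p => (l0 p)%:E))
  (d : measure_display) (Omega : measurableType d) (P : probability Omega R)
  (UV : nat -> {RV P >-> (borelType U * measurableTypeR R)%type})
  (stationaryUV : stationary P UV) (ergodicUV : ergodic P UV)
  (d' : measure_display) (Omega' : measurableType d')
  (Q : probability Omega' R)
  (Z : {RV Q >-> (borelType U * measurableTypeR R)%type})
  (distrZ : forall A, measurable A ->
     distribution Q Z A = distribution P (UV 0%N) A)
  (theta : forall n, n.-tuple (borelType U * measurableTypeR R) -> Theta)
  (measurable_theta : forall n, (1 <= n)%N ->
     measurable_fun setT (theta n : _ -> borelType Theta)) :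
  let thetahat n w := theta n [tuple UV i w | i < n] in
  let risk n w := empirical_risk l0 f n (fun i => UV i w) in
  {ae P, forall w, exists l : R,
     risk n w (thetahat n w) @[n --> \oo] --> l /\
     inf (range (risk n w)) @[n --> \oo] --> l} ->
  (\int[Q]_w ereal_sup (range (fun t => (l0 (f t (Z w).1, (Z w).2))%:E))
     < +oo)%E ->
  {ae P, forall w, cvg_to_set (fun n => thetahat n w)
     (argmin (fun t => 'E_Q[fun w' => l0 (f t (Z w').1, (Z w').2)])%E)}.
Proof.
move=> thetahat risk optimal _.
have scU := polish_second_countable polishU.
have lsc_loss := jointly_lsc_loss cont_f lsc_l0.
have loss_ge0 t (x : U * R) : 0 <= l0 (f t x.1, x.2) by [].
pose loss t (x : U * R) := l0 (f t x.1, x.2).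
(* Z has the law of the first observation, so both have the same expected loss. *)
have -> : (fun t => 'E_Q[fun w' => l0 (f t (Z w').1, (Z w').2)])%E =
    expected_risk loss (UV 0%N).
  apply/funext => t; rewrite unlock.
  have mloss : measurable_fun setT (EFin \o
      (loss t : borelType U * measurableTypeR R -> measurableTypeR R)).
    by apply/measurable_EFinP; exact: measurable_loss.
  have loss0 x : (0 <= (EFin \o loss t) x)%E.
    by rewrite /= lee_fin; exact: loss_ge0.
  rewrite -[LHS](ge0_integral_distribution Z mloss loss0).
  rewrite -[RHS](ge0_integral_distribution (UV 0%N) mloss loss0).
  by apply: eq_measure_integral => A mA _; exact: distrZ.
exact: (ae_cvg_argmin scU compactTheta lsc_loss loss_ge0 stationaryUV ergodicUV
  optimal).
Qed.
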